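(* The Recoverable Polymatroid Basis Problem $(\hat P_{\ge k})$ can be (polynomially) reduced to the Polymatroidal Flow Problem.
   Context: A polymatroid rank function on a finite set $E$ is a function $f\colon 2^E\to\mathbb{R}$ that is submodular, monotone ($f(U)\le f(V)$ for $U\subseteq V$) and normalized ($f(\emptyset)=0$). Its polymatroid base polytope is $\mathcal{B}(f)=\{x\in\mathbb{R}_+^{|E|}\mid x(U)\le f(U)\ \forall U\subseteq E,\ x(E)=f(E)\}$, where $x(U)=\sum_{e\in U}x_e$. For $x,y\in\mathbb{R}^{|E|}$, put $|x\wedge y|=\sum_{e\in E}\min\{x_e,y_e\}$. Problem $(\hat P_{\ge k})$ (Recoverable Polymatroid Basis Problem): given polymatroid rank functions $f_1,f_2$ on the same ground set $E$ (by evaluation oracles), cost functions $c_1,c_2\colon E\to\mathbb{R}$ and an integer $k$, minimize $\sum_{e\in E}c_1(e)x(e)+\sum_{e\in E}c_2(e)y(e)$ subject to $x\in\mathcal{B}(f_1)$, $y\in\mathcal{B}(f_2)$, $|x\wedge y|\ge k$. Polymatroidal Flow Problem: given a digraph $G=(V,A)$, arc costs $\gamma\colon A\to\mathbb{R}$, lower bounds $l\colon A\to\mathbb{R}$, and for each $v\in V$ submodular functions $f_v^+$ on $2^{\delta^+(v)}$ and $f_v^-$ on $2^{\delta^-(v)}$, where $\delta^+(v)$ and $\delta^-(v)$ are the sets of arcs leaving and entering $v$ (the constraint at a vertex may also be trivial, i.e. impose no restriction). Let $P(f_v^{\pm})=\{x\in\mathbb{R}^{\delta^{\pm}(v)}\mid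 x(U)\le f_v^{\pm}(U)\ \forall U\subseteq\delta^{\pm}(v)\}$. The task is to minimize $\sum_{a\in A}\gamma(a)\varphi(a)$ over $\varphi\colon A\to\mathbb{R}$ subject to $l(a)\le\varphi(a)$ for all $a\in A$; $\sum_{a\in\delta^-(v)}\varphi(a)-\sum_{a\in\delta^+(v)}\varphi(a)=0$ for all $v\in V$; and $\varphi|_{\delta^+(v)}\in P(f_v^+)$, $\varphi|_{\delta^-(v)}\in P(f_v^-)$ for all $v\in V$. ''Reduced'' means: from any instance of the first problem one can construct in polynomial time an equivalent instance of the second (with oracles for the new functions simulated in polynomial time by the given ones), such that optimal solutions of the second yield in polynomial time optimal solutions of the first. *)

(* Defs.v *)
From mathcomp Require Import all_boot all_order all_algebra.
From mathcomp Require Import reals.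

Set Implicit Arguments.
Unset Strict Implicit.
Unset Printing Implicit Defensive.

Import Order.TTheory GRing.Theory Num.Theory.
Local Open Scope ring_scope.

Section Polymatroids.
Variables (R : realType) (E : finType).
Implicit Types (f : {set E} -> R) (D U W : {set E}) (x : E -> R).

(* A function on 2^D is a function on {set E} of which only the values at
   subsets of D matter. *)
Definition submodular_on D f : Prop :=
  forall U W, U \subset D -> W \subset D ->
    f (U :|: W) + f (U :&: W) <= f U + f W.

Definition polymatroid_rank f : Prop :=
  [/\ submodular_on [set: E] f,
      forall U W, U \subset W -> f U <= f W
    & f set0 = 0].

Definition base_polytope f x : Prop :=
  [/\ forall e, 0 <= x e,
      forall U, \sum_(e in U) x e <= f U
    & \sum_e x e = f [set: E]].

(* P(f) for f on 2^D, [None] standing for the trivial constraint. *)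
Definition in_P D (F : option ({set E} -> R)) x : Prop :=
  if F is Some f then forall U, U \subset D -> \sum_(e in U) x e <= f U
  else True.

End Polymatroids.

(* A real RAM with oracle calls.  The memory consists of arrays of natural
   numbers and arrays of reals, named by numbers that are fixed in the program
   text; scalars are cells of index 0.  Programs contain no real constants and
   arithmetic is additive, so that numbers computed in polynomial time from
   rational data also have polynomial bit length.  Loops are bounded, which
   makes execution total; every iteration is charged. *)

Inductive nexp :=
  | NLit of nat
  | NGet of nat & nexp
  | NAdd of nexp & nexp
  | NSub of nexp & nexp.

Inductive rexp :=
  | RNat of nexp
  | RGet of nat & nexp
  | RAdd of rexp & rexp
  | RSub of rexp & rexp.

Inductive test :=
  | NLe of nexp & nexp
  | RLe of rexp & rexp.

Inductive cmd :=
  | Skip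
  | NSet (a : nat) (i e : nexp)
  | RSet (a : nat) (i : nexp) (e : rexp)
  | Ask (a : nat) (i : nexp) (q : nat) (m : nexp)
      (* a[i] := oracle's answer to the word q[0], ..., q[m-1] *)
  | Seq (c1 c2 : cmd)
  | If (b : test) (c1 c2 : cmd)
  | For (a : nat) (m : nexp) (c : cmd). (* for a[0] = 0, ..., m-1 do c *)

Section Semantics.
Variable R : realType.

Record state := State { nmem : nat -> nat -> nat; rmem : nat -> nat -> R }.

Definition upd (T : Type) (mem : nat -> nat -> T) (a i : nat) (v : T) :=
  fun b j => if (b == a) && (j == i) then v else mem b j.

Fixpoint neval (s : state) (e : nexp) : nat :=
  match e with
  | NLit c => c
  | NGet a i => nmem s a (neval s i)
  | NAdd e1 e2 => (neval s e1 + neval s e2)%N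
  | NSub e1 e2 => (neval s e1 - neval s e2)%N
  end.

Fixpoint reval (s : state) (e : rexp) : R :=
  match e with
  | RNat e => (neval s e)%:R
  | RGet a i => rmem s a (neval s i)
  | RAdd e1 e2 => reval s e1 + reval s e2
  | RSub e1 e2 => reval s e1 - reval s e2
  end.

Definition teval (s : state) (b : test) : bool :=
  match b with
  | NLe e1 e2 => (neval s e1 <= neval s e2)%N
  | RLe e1 e2 => reval s e1 <= reval s e2
  end.

(* Final state and running time.  Expressions cost a constant, their size being
   fixed by the program; an oracle call is charged the length of its word. *)
Fixpoint exec (O : seq nat -> R) (c : cmd) (s : state) : state * nat :=
  match c with
  | Skip => (s, 1%N)
  | NSet a i e =>
      (State (upd (nmem s) a (neval s i) (neval s e)) (rmem s), 1%N)
  | RSet a i e =>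
      (State (nmem s) (upd (rmem s) a (neval s i) (reval s e)), 1%N)
  | Ask a i q m =>
      let w := mkseq (nmem s q) (neval s m) in
      (State (nmem s) (upd (rmem s) a (neval s i) (O w)), (size w).+1)
  | Seq c1 c2 =>
      let: (s1, t1) := exec O c1 s in
      let: (s2, t2) := exec O c2 s1 in
      (s2, (t1 + t2)%N)
  | If b c1 c2 =>
      let: (s', t) := exec O (if teval s b then c1 else c2) s in (s', t.+1)
  | For a m c =>
      iteri (neval s m)
        (fun j st =>
           let: (s1, t1) := st in
           let: (s2, t2) := exec O c (State (upd (nmem s1) a 0 j) (rmem s1)) in
           (s2, (t1 + t2).+1))
        (s, 1%N)
  end.

(* Arrays number 0, 1, ... are initialized from the given lists, every other
   cell is 0. *)
Definition load (N : seq (seq nat)) (M : seq (seq R)) : state :=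
  State (fun a j => nth 0%N (nth [::] N a) j)
        (fun a j => nth 0 (nth [::] M a) j).

Definition holds (s : state) (N : seq (seq nat)) (M : seq (seq R)) : Prop :=
  (forall a j, (j < size (nth [::] N a))%N ->
     nmem s a j = nth 0%N (nth [::] N a) j) /\
  (forall a j, (j < size (nth [::] M a))%N ->
     rmem s a j = nth 0 (nth [::] M a) j).

End Semantics.

(* An instance is presented to a program by finitely many arrays together with
   an oracle answering words of natural numbers; [None] marks the words that
   are not queries. *)
Record problem (R : realType) := Problem {
  inst : Type;
  valid : inst -> Prop;
  nat_data : inst -> seq (seq nat);
  real_data : inst -> seq (seq R);
  oracle : inst -> seq nat -> option R;
  solution : inst -> Type;
  feasible : forall I : inst, solution I -> Prop;
  objective : forall I : inst, solution I -> R;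
  sol_data : forall I : inst, solution I -> seq (seq R)
}.

Section Reductions.
Variable R : realType.

Definition optimal (P : problem R) (I : inst P) (x : solution I) : Prop :=
  feasible x /\
  forall x' : solution I, feasible x' -> objective x <= objective x'.

(* Number of entries of the explicit data: a unit for every number, so the time
   bounds below are strongly polynomial. *)
Definition isize (P : problem R) (I : inst P) : nat :=
  (sumn (shape (nat_data I)) + sumn (shape (real_data I)))%N.

(* N and M are loaded behind the arrays presenting I; N' and M' are the expected
   output.  A word that is not a query is answered by 0. *)
Definition computes (P : problem R) (I : inst P) (c : cmd) (T : nat)
    (N : seq (seq nat)) (M : seq (seq R))
    (N' : seq (seq nat)) (M' : seq (seq R)) : Prop :=
  let: (s, t) := exec (fun w => odflt 0 (oracle I w)) c
                      (load (nat_data I ++ N) (real_data I ++ M)) in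
  (t <= T)%N /\ holds s N' M'.

(* Same feasibility and same infimum, attained in one iff in the other. *)
Definition equivalent (P Q : problem R) (I : inst P) (J : inst Q) : Prop :=
  forall t : R,
    (exists x : solution I, feasible x /\ objective x <= t) <->
    (exists y : solution J, feasible y /\ objective y <= t).

(* [build] writes down the new instance, [sim] simulates its oracle, and [back]
   translates optimal solutions; the programs and the bound C (N+1)^d are
   uniform in the instance. *)
Definition poly_reducible (P Q : problem R) : Prop :=
  exists (build sim back : cmd) (C d : nat),
  forall I : inst P, valid I ->
  exists J : inst Q,
    let T := (C * (isize I).+1 ^ d)%N in
    [/\ valid J /\ (isize J <= T)%N,
        computes I build T [::] [::] (nat_data J) (real_data J),
        forall (w : seq nat) (r : R), oracle J w = Some r ->
          computes I sim T [:: w] [::] [::] [:: [:: r]],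
        equivalent I J
      & forall y : solution J, optimal y ->
          exists x : solution I,
            optimal x /\ computes I back T [::] (sol_data y) [::] (sol_data x)].

End Reductions.

(* The subset of {0, ..., n-1} with the given 0/1 incidence vector. *)
Definition set_of_bits (n : nat) (bits : seq nat) : {set 'I_n} :=
  [set i : 'I_n | nth 0%N bits i != 0%N].

Section Recoverable.
Variable R : realType.

Record rpb_inst := RpbInst {
  rpb_n : nat;
  rpb_f1 : {set 'I_rpb_n} -> R;
  rpb_f2 : {set 'I_rpb_n} -> R;
  rpb_c1 : 'I_rpb_n -> R;
  rpb_c2 : 'I_rpb_n -> R;
  rpb_k : int
}.

Definition rpb_valid (I : rpb_inst) : Prop :=
  polymatroid_rank (@rpb_f1 I) /\ polymatroid_rank (@rpb_f2 I).

Definition rpb_nat_data (I : rpb_inst) : seq (seq nat) := [:: [:: rpb_n I]].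

Definition rpb_real_data (I : rpb_inst) : seq (seq R) :=
  [:: [:: (rpb_k I)%:~R]; codom (@rpb_c1 I); codom (@rpb_c2 I)].

Definition rpb_oracle (I : rpb_inst) (w : seq nat) : option R :=
  match w with
  | 0%N :: bits => Some (@rpb_f1 I (set_of_bits _ bits))
  | 1%N :: bits => Some (@rpb_f2 I (set_of_bits _ bits))
  | _ => None
  end.

Definition rpb_solution (I : rpb_inst) : Type :=
  (('I_(rpb_n I) -> R) * ('I_(rpb_n I) -> R))%type.

Definition rpb_feasible (I : rpb_inst) (xy : rpb_solution I) : Prop :=
  let: (x, y) := xy in
  [/\ base_polytope (@rpb_f1 I) x,
      base_polytope (@rpb_f2 I) y
    & (rpb_k I)%:~R <= \sum_e Num.min (x e) (y e)].

Definition rpb_objective (I : rpb_inst) (xy : rpb_solution I) : R :=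
  let: (x, y) := xy in
  \sum_e rpb_c1 e * x e + \sum_e rpb_c2 e * y e.

Definition rpb_sol_data (I : rpb_inst) (xy : rpb_solution I) : seq (seq R) :=
  [:: codom xy.1; codom xy.2].

Definition recoverable_polymatroid_basis : problem R :=
  Problem rpb_valid rpb_nat_data rpb_real_data rpb_oracle
    rpb_feasible rpb_objective rpb_sol_data.

End Recoverable.

Section PolymatroidalFlow.
Variable R : realType.

Record pf_inst := PfInst {
  pf_nv : nat;
  pf_na : nat;
  pf_tail : 'I_pf_na -> 'I_pf_nv;
  pf_head : 'I_pf_na -> 'I_pf_nv;
  pf_cost : 'I_pf_na -> R;
  pf_lower : 'I_pf_na -> R;
  pf_fout : 'I_pf_nv -> option ({set 'I_pf_na} -> R);
  pf_fin : 'I_pf_nv -> option ({set 'I_pf_na} -> R)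
}.

Definition delta_out (J : pf_inst) (v : 'I_(pf_nv J)) : {set 'I_(pf_na J)} :=
  [set a | pf_tail a == v].

Definition delta_in (J : pf_inst) (v : 'I_(pf_nv J)) : {set 'I_(pf_na J)} :=
  [set a | pf_head a == v].

(* Injectivity says that the arcs form a subset of V x V (no parallel arcs). *)
Definition pf_valid (J : pf_inst) : Prop :=
  [/\ injective (fun a : 'I_(pf_na J) => (pf_tail a, pf_head a)),
      forall (v : 'I_(pf_nv J)) f,
        pf_fout v = Some f -> submodular_on (delta_out v) f
    & forall (v : 'I_(pf_nv J)) f,
        pf_fin v = Some f -> submodular_on (delta_in v) f].

(* The last two arrays tell which vertex constraints are nontrivial. *)
Definition pf_nat_data (J : pf_inst) : seq (seq nat) :=
  [:: [:: pf_nv J; pf_na J];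
      codom (fun a : 'I_(pf_na J) => pf_tail a : nat);
      codom (fun a : 'I_(pf_na J) => pf_head a : nat);
      codom (fun v : 'I_(pf_nv J) => isSome (pf_fout v) : nat);
      codom (fun v : 'I_(pf_nv J) => isSome (pf_fin v) : nat)].

Definition pf_real_data (J : pf_inst) : seq (seq R) :=
  [:: codom (@pf_cost J); codom (@pf_lower J)].

Definition value_on (E : finType) (D : {set E}) (F : option ({set E} -> R))
    (U : {set E}) : option R :=
  if F is Some f then if U \subset D then Some (f U) else None else None.

(* Queries are (0, v, U) for f_v^+(U) and (1, v, U) for f_v^-(U). *)
Definition pf_oracle (J : pf_inst) (w : seq nat) : option R :=
  if w is b :: v :: bits then
    if (insub v : option 'I_(pf_nv J)) is Some v then
      let U := set_of_bits (pf_na J) bits in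
      match b with
      | 0%N => value_on (delta_out v) (pf_fout v) U
      | 1%N => value_on (delta_in v) (pf_fin v) U
      | _ => None
      end
    else None
  else None.

Definition pf_solution (J : pf_inst) : Type := 'I_(pf_na J) -> R.

Definition pf_feasible (J : pf_inst) (phi : pf_solution J) : Prop :=
  [/\ forall a, pf_lower a <= phi a,
      forall v : 'I_(pf_nv J),
        \sum_(a in delta_in v) phi a - \sum_(a in delta_out v) phi a = 0,
      forall v : 'I_(pf_nv J), in_P (delta_out v) (pf_fout v) phi
    & forall v : 'I_(pf_nv J), in_P (delta_in v) (pf_fin v) phi].

Definition pf_objective (J : pf_inst) (phi : pf_solution J) : R :=
  \sum_a pf_cost a * phi a.

Definition pf_sol_data (J : pf_inst) (phi : pf_solution J) : seq (seq R) :=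
  [:: codom phi].

Definition polymatroidal_flow : problem R :=
  Problem pf_valid pf_nat_data pf_real_data pf_oracle
    pf_feasible pf_objective pf_sol_data.

End PolymatroidalFlow.

(* Main.v *)
Require Import Defs.
From mathcomp Require Import all_boot all_order all_algebra.
From mathcomp Require Import reals.
From mathcomp Require Import zify lra.

(** The bases are encoded in the following network.  A source sends [x e] to the
    vertex of each element [e], under the constraint [f1], and this vertex sends
    [y e] to a sink, under the constraint [f2].  The difference [x e - y e] is
    absorbed by two nonnegative arcs: [p e] leads from the vertex of [e] to a
    pool, [q e] from a hub to the vertex of [e].  Conservation at this vertex
    says [x e - p e = y e - q e].

    The amount [x e - p e] is then a lower bound of [min (x e) (y e)], and it
    equals the minimum for the smallest choice of [p] and [q].  So the condition
    on the meet of [x] and [y] is that the total of [p] can be made at most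
    [x(E) - k].  Arcs have lower bounds only, but these may be negative: the
    arc from the hub to the pool carries the negative of the total of [p], and
    gets the lower bound [k - f1(E)].  An arc from the hub to the source carries
    [x(E)], an arc from the sink to the hub [y(E)]; the lower bounds [f1(E)] and
    [f2(E)], together with the submodular constraints, turn [x] and [y] into
    bases.  Costs sit on the arcs of [x] and [y] only, so feasible solutions
    correspond with equal objective values ([flow_to_bases], [bases_to_flow]),
    and optimal flows restrict to optimal pairs of bases.

    The network has [n + 4] vertices, [4 n + 3] arcs, none parallel, and its two
    constraint functions are [f1] and [f2] read on a block of arcs.  Hence one
    query suffices to simulate a query, two queries and linearly many steps to
    write the network down, and copying two blocks recovers the bases
    ([sim_correct], [build_correct], [back_correct]). *)

Set Implicit Arguments.
Unset Strict Implicit.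
Unset Printing Implicit Defensive.

Import Order.TTheory GRing.Theory Num.Theory.
Local Open Scope ring_scope.

(** * Generalities *)

Lemma nth_codom_ord (T : Type) (m : nat) (z : T) (f : 'I_m -> T) (i : 'I_m) :
  nth z (codom f) i = f i.
Proof.
by rewrite /codom /image_mem (nth_map i) ?size_enum_ord // nth_ord_enum.
Qed.

Lemma preimset_submodular (R : realType) (A B : finType) (f : {set A} -> R)
    (g : A -> B) (D : {set B}) :
  submodular_on [set: A] f -> submodular_on D (fun U => f (g @^-1: U)).
Proof.
by move=> sub U W _ _; rewrite preimsetU preimsetI; apply: sub; apply: subsetT.
Qed.

(** The polymatroid of a function pulled back along an injection [g] is the
    original polymatroid, because a set inside the image of [g] is the image
    of its preimage. *)
Lemma in_P_imset (R : realType) (A B : finType) (g : A -> B)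
    (f : {set A} -> R) (phi : B -> R) :
  injective g ->
  in_P (g @: [set: A]) (Some (fun U : {set B} => f (g @^-1: U))) phi <->
  forall U : {set A}, \sum_(e in U) phi (g e) <= f U.
Proof.
move=> g_inj.
have gK (U : {set A}) : g @^-1: (g @: U) = U.
  by apply/setP=> e; rewrite inE mem_imset.
split=> [le_f U | le_f W /subsetP sWg].
  rewrite -[in f U](gK U) -(big_imset _ (in2W g_inj)) /=.
  by apply: le_f; apply: imsetS; apply: subsetT.
have -> : \sum_(a in W) phi a = \sum_(e in g @^-1: W) phi (g e).
  rewrite -(big_imset _ (in2W g_inj)) /=.
  apply: eq_bigl => a; apply/idP/imsetP => [Wa | [e + ->]]; last by rewrite inE.
  by have /imsetP[e _ ae] := sWg a Wa; exists e; rewrite // inE -ae.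
exact: le_f.
Qed.

Local Notation r0 := (@Ordinal 3 0 isT).
Local Notation r1 := (@Ordinal 3 1 isT).
Local Notation r2 := (@Ordinal 3 2 isT).

Lemma big_ord3 (V : nmodType) (P : pred 'I_3) (F : 'I_3 -> V) :
  \sum_(i | P i) F i =
  (if P r0 then F r0 else 0) + (if P r1 then F r1 else 0)
  + (if P r2 then F r2 else 0).
Proof.
rewrite big_mkcond 3!big_ord_recl big_ord0 /= addr0 addrA.
have -> : ord0 = r0 by exact: val_inj.
have -> : lift r0 ord0 = r1 by exact: val_inj.
by have -> : lift r0 (lift ord0 ord0) = r2 by exact: val_inj.
Qed.

(** * The network *)

Section Network.
Variable R : realType.

Record arc_spec := ArcSpec {
  src : nat; dst : nat; price : R; least : R
}.

Definition source := 0%N.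
Definition sink := 1%N.
Definition hub := 2%N.
Definition pool := 3%N.
Definition node (e : nat) := (4 + e)%N.

(** The arcs come in four blocks of [n], one arc per element, followed by the
    three arcs that carry totals.  The table is kept in this numerical form
    because the program that writes the network is a copy of it. *)
Definition arc_table (n : nat) (c1 c2 : seq R) (r1 r2 k : R) (a : nat) :
    arc_spec :=
  (if a < n then ArcSpec source (node a) c1`_a 0
   else if a < n + n then ArcSpec (node (a - n)) sink c2`_(a - n) 0
   else if a < n + n + n then ArcSpec (node (a - (n + n))) pool 0 0
   else if a < n + n + (n + n) then ArcSpec hub (node (a - (n + n + n))) 0 0
   else if a < n + n + (n + n) + 1 then ArcSpec hub source 0 r1
   else if a < n + n + (n + n) + 2 then ArcSpec sink hub 0 r2
   else ArcSpec hub pool 0 (k - r1))%N.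

Variable I : rpb_inst R.
Local Notation n := (rpb_n I).
Local Notation rank1 := (@rpb_f1 R I [set: 'I_n]).
Local Notation rank2 := (@rpb_f2 R I [set: 'I_n]).
Local Notation k := ((rpb_k I)%:~R : R).

Definition arcs : nat -> arc_spec :=
  arc_table n (codom (@rpb_c1 R I)) (codom (@rpb_c2 R I)) rank1 rank2 k.

Definition num_arcs := (n + n + (n + n) + 3)%N.

(** The flow on [xarc e] and [yarc e] is the pair of bases.  The arcs [parc e]
    and [qarc e] let [node e] balance, so they carry at least the excess of
    [x e] over [y e] and of [y e] over [x e] respectively. *)
Definition xarc (e : 'I_n) : 'I_num_arcs :=
  lshift 3 (lshift (n + n) (lshift n e)).
Definition yarc (e : 'I_n) : 'I_num_arcs :=
  lshift 3 (lshift (n + n) (rshift n e)).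
Definition parc (e : 'I_n) : 'I_num_arcs :=
  lshift 3 (rshift (n + n) (lshift n e)).
Definition qarc (e : 'I_n) : 'I_num_arcs :=
  lshift 3 (rshift (n + n) (rshift n e)).
Definition rarc (i : 'I_3) : 'I_num_arcs := rshift (n + n + (n + n)) i.
Local Notation total1 := (rarc r0).
Local Notation total2 := (rarc r1).
Local Notation excess := (rarc r2).

(** Only the source and the sink are constrained: the arcs leaving the source
    are exactly the [xarc e], and those entering the sink are the [yarc e]. *)
Definition network : pf_inst R := @PfInst R n.+4 num_arcs
  (fun a => inord (src (arcs a))) (fun a => inord (dst (arcs a)))
  (fun a => price (arcs a)) (fun a => least (arcs a))
  (fun v => if v == source :> nat
            then Some (fun U : {set 'I_num_arcs} => rpb_f1 (xarc @^-1: U))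
            else None)
  (fun v => if v == sink :> nat
            then Some (fun U : {set 'I_num_arcs} => rpb_f2 (yarc @^-1: U))
            else None).

Ltac arc_tac := rewrite /arcs /arc_table /=;
  repeat (case: ifP => //; try lia); move=> *;
  rewrite ?addKn ?nth_codom_ord //; congr ArcSpec; congr node; lia.

Lemma arcs_x (e : 'I_n) : arcs (xarc e) = ArcSpec source (node e) (rpb_c1 e) 0.
Proof. by rewrite /arcs /arc_table /= ltn_ord nth_codom_ord. Qed.

Lemma arcs_y (e : 'I_n) : arcs (yarc e) = ArcSpec (node e) sink (rpb_c2 e) 0.
Proof. have := ltn_ord e; arc_tac. Qed.

Lemma arcs_p (e : 'I_n) : arcs (parc e) = ArcSpec (node e) pool 0 0.
Proof. have := ltn_ord e; arc_tac. Qed.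

Lemma arcs_q (e : 'I_n) : arcs (qarc e) = ArcSpec hub (node e) 0 0.
Proof. have := ltn_ord e; arc_tac. Qed.

Lemma arcs_r (i : 'I_3) : arcs (rarc i) =
  nth (ArcSpec hub pool 0 (k - rank1))
    [:: ArcSpec hub source 0 rank1; ArcSpec sink hub 0 rank2] i.
Proof.
rewrite /arcs /arc_table /=.
do 4! (case: ifP; first by lia); move=> _ _ _ _.
rewrite !ltn_add2l.
by case: i => [[|[|[|]]]].
Qed.

Lemma big_arcs (P : pred 'I_num_arcs) (phi : 'I_num_arcs -> R) :
  \sum_(a | P a) phi a =
  \sum_(e | P (xarc e)) phi (xarc e) + \sum_(e | P (yarc e)) phi (yarc e) +
  (\sum_(e | P (parc e)) phi (parc e) + \sum_(e | P (qarc e)) phi (qarc e)) +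
  \sum_(i | P (rarc i)) phi (rarc i).
Proof. by rewrite !big_split_ord. Qed.

Lemma arc_ind (P : 'I_num_arcs -> Prop) :
  (forall e, P (xarc e)) -> (forall e, P (yarc e)) ->
  (forall e, P (parc e)) -> (forall e, P (qarc e)) ->
  (forall i, P (rarc i)) -> forall a, P a.
Proof.
move=> Px Py Pp Pq Pr a; case: (split_ordP a) => [b|i] ->; last exact: Pr.
case: (split_ordP b) => c ->; case: (split_ordP c) => e ->.
- exact: Px. - exact: Py. - exact: Pp. - exact: Pq.
Qed.

Lemma arcs_bound (a : 'I_num_arcs) :
  (src (arcs a) < n.+4)%N /\ (dst (arcs a) < n.+4)%N.
Proof.
elim/arc_ind: a => [e|e|e|e|i];
  rewrite ?(arcs_x, arcs_y, arcs_p, arcs_q, arcs_r).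
5: by case: i => [[|[|[|]]]].
all: by rewrite /= /node /source /sink /pool /hub;
  have := ltn_ord e; split; lia.
Qed.

Lemma tailE (a : 'I_num_arcs) : @pf_tail R network a = src (arcs a) :> nat.
Proof. by rewrite /= inordK // (arcs_bound a).1. Qed.

Lemma headE (a : 'I_num_arcs) : @pf_head R network a = dst (arcs a) :> nat.
Proof. by rewrite /= inordK // (arcs_bound a).2. Qed.

Definition arcE := (arcs_x, arcs_y, arcs_p, arcs_q, arcs_r).

Lemma network_simple :
  injective (fun a => (@pf_tail R network a, @pf_head R network a)).
Proof.
move=> a b [] /(congr1 val) + /(congr1 val); rewrite /= !tailE !headE.
elim/arc_ind: a => [e|e|e|e|i]; elim/arc_ind: b => [f|f|f|f|j]; rewrite !arcE.
25: by case: i => [[|[|[|]]] //= ?]; case: j => [[|[|[|]]] //= ?] => *;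
       congr rarc; apply: val_inj.
5, 10, 15, 20: by case: j => [[|[|[|]]]].
17, 18, 19, 20: by case: i => [[|[|[|]]]].
all: rewrite /= /source /sink /hub /pool /node => h1 h2; try lia.
all: have -> // : e = f by apply: val_inj => /=; lia.
Qed.

Lemma network_valid : rpb_valid I -> pf_valid network.
Proof.
move=> [rk1 rk2]; split; first exact: network_simple.
- by move=> v f /=; case: ifP => // _ [<-]; apply: preimset_submodular;
    case: rk1.
- by move=> v f /=; case: ifP => // _ [<-]; apply: preimset_submodular;
    case: rk2.
Qed.

Lemma inflowE (phi : 'I_num_arcs -> R) (v : 'I_n.+4) :
  \sum_(a in @delta_in R network v) phi a =
  \sum_(e : 'I_n | node e == v) phi (xarc e) +
  \sum_(e : 'I_n | sink == v) phi (yarc e) +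
  (\sum_(e : 'I_n | pool == v) phi (parc e) +
   \sum_(e : 'I_n | node e == v) phi (qarc e)) +
  \sum_(i < 3 | nth pool [:: source; hub] i == v) phi (rarc i).
Proof.
rewrite big_arcs; congr (_ + _ + (_ + _) + _); apply: eq_bigl => e;
  rewrite inE -(inj_eq val_inj) [val (pf_head _)]headE !arcE //.
by case: e => [[|[|[|]]]].
Qed.

Lemma outflowE (phi : 'I_num_arcs -> R) (v : 'I_n.+4) :
  \sum_(a in @delta_out R network v) phi a =
  \sum_(e : 'I_n | source == v) phi (xarc e) +
  \sum_(e : 'I_n | node e == v) phi (yarc e) +
  (\sum_(e : 'I_n | node e == v) phi (parc e) +
   \sum_(e : 'I_n | hub == v) phi (qarc e)) +
  \sum_(i < 3 | nth hub [:: hub; sink] i == v) phi (rarc i).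
Proof.
rewrite big_arcs; congr (_ + _ + (_ + _) + _); apply: eq_bigl => e;
  rewrite inE -(inj_eq val_inj) [val (pf_tail _)]tailE !arcE //.
by case: e => [[|[|[|]]]].
Qed.

Definition conservative (phi : 'I_num_arcs -> R) :=
  forall v, \sum_(a in @delta_in R network v) phi a
          - \sum_(a in @delta_out R network v) phi a = 0.

(** One equation per vertex: source, sink, pool, hub, elements.  By the pool
    equation the arc from the hub to the pool carries the negative of the total
    of the [parc e], which turns its lower bound into an upper bound on that
    total. *)
Lemma conservativeP (phi : 'I_num_arcs -> R) :
  conservative phi <->
  [/\ phi total1 = \sum_e phi (xarc e),
      phi total2 = \sum_e phi (yarc e),
      phi excess = - \sum_e phi (parc e),
      phi total1 + phi excess + \sum_e phi (qarc e) = phi total2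
    & forall e, phi (xarc e) + phi (qarc e) = phi (yarc e) + phi (parc e)].
Proof.
have eqs (v : 'I_n.+4) :
    \sum_(a in @delta_in R network v) phi a
      - \sum_(a in @delta_out R network v) phi a = 0 <->
    match val v with
    | 0%N => phi total1 = \sum_e phi (xarc e)
    | 1%N => phi total2 = \sum_e phi (yarc e)
    | 2%N => phi total1 + phi excess + \sum_e phi (qarc e) = phi total2
    | 3%N => phi excess = - \sum_e phi (parc e)
    | e.+4 => forall f : 'I_n, f = e :> nat ->
      phi (xarc f) + phi (qarc f) = phi (yarc f) + phi (parc f)
    end.
  rewrite inflowE outflowE !big_ord3 /=.
  case: v => [[|[|[|[|e]]]] lte] /=; rewrite ?big_pred0_eq.
  1-4: by split; lra.
  pose f : 'I_n := Ordinal (lte : (e < n)%N).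
  rewrite !(big_pred1 f) //.
  split=> [h g ge|/(_ f erefl)]; last by lra.
  by have -> : g = f; [exact: val_inj | lra].
split=> [cons|[c0 c1 c2 c3 c4] v].
  split.
  - exact/(eqs (@Ordinal n.+4 0 isT)).
  - exact/(eqs (@Ordinal n.+4 1 isT)).
  - exact/(eqs (@Ordinal n.+4 3 isT)).
  - exact/(eqs (@Ordinal n.+4 2 isT)).
  - move=> e; pose v := @Ordinal n.+4 e.+4 (ltn_ord e).
    by have /(eqs v) := cons v; apply.
apply/eqs.
by case: v => [[|[|[|[|e]]]] lte].
Qed.

Lemma delta_out_source (v : 'I_n.+4) :
  v = source :> nat -> @delta_out R network v = xarc @: [set: 'I_n].
Proof.
move=> vs; apply/setP=> a; rewrite inE -(inj_eq val_inj).
rewrite [val (pf_tail _)]tailE [val v]vs.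
elim/arc_ind: a => [e|e|e|e|i]; rewrite !arcE.
1: by rewrite imset_f.
4: case: i => [[|[|[|]]]] //= ?.
all: by apply/esym/imsetP => -[f _ /(congr1 val)] /=; have := ltn_ord f; lia.
Qed.

Lemma delta_in_sink (v : 'I_n.+4) :
  v = sink :> nat -> @delta_in R network v = yarc @: [set: 'I_n].
Proof.
move=> vs; apply/setP=> a; rewrite inE -(inj_eq val_inj).
rewrite [val (pf_head _)]headE [val v]vs.
elim/arc_ind: a => [e|e|e|e|i]; rewrite !arcE.
2: by rewrite imset_f.
4: case: i => [[|[|[|]]]] //= ?.
all: apply/esym/imsetP => -[f _ /(congr1 val)] /=; have := ltn_ord f;
  try have := ltn_ord e; lia.
Qed.

Lemma network_feasibleP (phi : 'I_num_arcs -> R) :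
  @pf_feasible R network phi <->
  [/\ [/\ forall e, 0 <= phi (xarc e), forall e, 0 <= phi (yarc e),
          forall e, 0 <= phi (parc e) & forall e, 0 <= phi (qarc e)],
      [/\ rank1 <= phi total1, rank2 <= phi total2
        & k - rank1 <= phi excess],
      conservative phi,
      forall U : {set 'I_n}, \sum_(e in U) phi (xarc e) <= rpb_f1 U
    & forall U : {set 'I_n}, \sum_(e in U) phi (yarc e) <= rpb_f2 U].
Proof.
have xinj : injective xarc by move=> e f /(congr1 val) /= ?; apply: val_inj.
have yinj : injective yarc.
  by move=> e f /(congr1 val) /= ?; apply: val_inj => /=; lia.
have s_out := in_P_imset (@rpb_f1 R I) phi xinj.
have t_in := in_P_imset (@rpb_f2 R I) phi yinj.
pose lower_bounds := forall a : 'I_num_arcs, least (arcs a) <= phi a.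
split=> [[low' cons out inn] |
  [[x0 y0 p0 q0] [l0 l1 l2] cons /s_out out /t_in inn]].
  have {low'} low : lower_bounds := low'.
  split=> //.
  - by split=> e; [have := low (xarc e)|have := low (yarc e)
                  |have := low (parc e)|have := low (qarc e)]; rewrite arcE.
  - by split; [have := low total1|have := low total2|have := low excess];
      rewrite arcE.
  - by apply/s_out; rewrite
      -(@delta_out_source (Ordinal (isT : 0 < n.+4)%N) erefl); apply: out.
  - by apply/t_in; rewrite
      -(@delta_in_sink (Ordinal (isT : 1 < n.+4)%N) erefl); apply: inn.
split=> [|//|v|v] /=.
- suff: lower_bounds by [].
  move=> a; elim/arc_ind: a => [e|e|e|e|i]; rewrite arcE //.
  by case: i => [[|[|[|]]]] //= lti; rewrite (bool_irrelevance lti isT).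
- by case: eqP => [vs|//]; rewrite (delta_out_source vs).
- by case: eqP => [vs|//]; rewrite (delta_in_sink vs).
Qed.

Lemma network_objective (phi : 'I_num_arcs -> R) :
  @pf_objective R network phi =
  @rpb_objective R I (phi \o xarc, phi \o yarc).
Proof.
rewrite /pf_objective /= big_arcs.
rewrite [X in _ + (X + _) + _]big1 => [|e _]; last by rewrite arcE mul0r.
rewrite [X in _ + (_ + X) + _]big1 => [|e _]; last by rewrite arcE mul0r.
rewrite [X in _ + X]big1 => [|[[|[|[|]]]] // ? _]; try by rewrite arcE mul0r.
by rewrite !addr0; congr (_ + _); apply: eq_bigr => e _; rewrite arcE.
Qed.

(** Conservation at [node e] makes [x e - p e = y e - q e], a common lower bound
    of [x e] and [y e]; its sum is the total of [x] minus the total of [p],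
    hence at least [k]. *)
Lemma flow_to_bases (phi : 'I_num_arcs -> R) :
  @pf_feasible R network phi -> @rpb_feasible R I (phi \o xarc, phi \o yarc).
Proof.
case/network_feasibleP=> -[x0 y0 p0 q0] [l0 l1 l2] /conservativeP.
case=> c0 c1 c2 _ ce out inn.
have sumT (F : 'I_n -> R) : \sum_(e in [set: 'I_n]) F e = \sum_e F e.
  by apply: eq_bigl => e; rewrite inE.
split.
- split=> //; apply/le_anti; rewrite -c0 /= l0 andbT c0 -sumT; exact: out.
- split=> //; apply/le_anti; rewrite -c1 /= l1 andbT c1 -sumT; exact: inn.
apply: (@le_trans _ _ (\sum_e (phi (xarc e) - phi (parc e)))).
  by rewrite sumrB; lra.
apply: ler_sum => e _ /=; rewrite le_min.
have := ce e; have := p0 e; have := q0 e; lra.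
Qed.

Definition flow_of_blocks (x y p q : 'I_n -> R) (r : seq R) :
    'I_num_arcs -> R :=
  fun a => match split a with
  | inl b => match split b with
             | inl c => match split c with inl e => x e | inr e => y e end
             | inr c => match split c with inl e => p e | inr e => q e end
             end
  | inr i => r`_i
  end.

Lemma flow_of_blocksE x y p q r (phi := flow_of_blocks x y p q r) :
  (forall e, phi (xarc e) = x e) * (forall e, phi (yarc e) = y e) *
  (forall e, phi (parc e) = p e) * (forall e, phi (qarc e) = q e) *
  (forall i, phi (rarc i) = r`_i).
Proof.
have inlK (a b : nat) i : split (lshift b i) = inl i := @unsplitK a b (inl i).
have inrK (a b : nat) i : split (rshift a i) = inr i := @unsplitK a b (inr i).
by do !split; move=> i; rewrite /phi /flow_of_blocks !(inlK, inrK).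
Qed.

(** Conversely the excess arcs carry [x e] and [y e] minus their minimum, the
    smallest amounts for which every [node e] balances. *)
Lemma bases_to_flow (x y : 'I_n -> R) : @rpb_feasible R I (x, y) ->
  exists phi : 'I_num_arcs -> R,
    @pf_feasible R network phi /\
    @pf_objective R network phi = @rpb_objective R I (x, y).
Proof.
case=> -[x0 xf xE] [y0 yf yE] km.
pose m e := Num.min (x e) (y e).
pose phi := flow_of_blocks x y (fun e => x e - m e) (fun e => y e - m e)
  [:: rank1; rank2; \sum_e m e - rank1].
have := flow_of_blocksE x y (fun e => x e - m e) (fun e => y e - m e)
  [:: rank1; rank2; \sum_e m e - rank1].
rewrite -/phi => phiE.
exists phi; split; last first.
  by rewrite network_objective; congr (_ + _);
    apply: eq_bigr => e _; rewrite [(phi \o _) e]phiE.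
have px : \sum_e phi (xarc e) = rank1 by under eq_bigr do rewrite phiE.
have py : \sum_e phi (yarc e) = rank2 by under eq_bigr do rewrite phiE.
have pp : \sum_e phi (parc e) = rank1 - \sum_e m e.
  by under eq_bigr do rewrite phiE; rewrite sumrB xE.
have pq : \sum_e phi (qarc e) = rank2 - \sum_e m e.
  by under eq_bigr do rewrite phiE; rewrite sumrB yE.
apply/network_feasibleP; split.
- split=> e; rewrite phiE //= subr_ge0 /m ge_min lexx ?orbT //.
- by rewrite !phiE /=; split=> //; rewrite lerD2r.
- by apply/conservativeP; rewrite px py pp pq !phiE /=; split=> [||||e];
    rewrite ?phiE; lra.
- by move=> U; under eq_bigr do rewrite phiE; apply: xf.
- by move=> U; under eq_bigr do rewrite phiE; apply: yf.
Qed.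

Lemma network_equivalent :
  @equivalent R (recoverable_polymatroid_basis R) (polymatroidal_flow R)
    I network.
Proof.
move=> t; split=> [[[x y] [feas le_t]] | [phi [feas le_t]]].
  by have [phi [pf obj]] := bases_to_flow feas; exists phi;
    split; rewrite //= obj.
exists (phi \o xarc, phi \o yarc); split; first exact: flow_to_bases.
by move: le_t; rewrite /= network_objective.
Qed.

Lemma optimal_flow_to_bases (phi : 'I_num_arcs -> R) :
  @optimal R (polymatroidal_flow R) network phi ->
  @optimal R (recoverable_polymatroid_basis R) I (phi \o xarc, phi \o yarc).
Proof.
case=> feas opt; split=> [|[x y] feas']; first exact: flow_to_bases.
have [psi [pf obj]] := bases_to_flow feas'.
by have := opt psi pf; rewrite /= obj network_objective.
Qed.
End Network.

(** * Reasoning about programs *)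

Lemma upd_other (T : Type) (mem : nat -> nat -> T) a i v b j :
  b != a -> upd mem a i v b j = mem b j.
Proof. by rewrite /upd => /negbTE->. Qed.

Section Programs.
Variable R : realType.
Variable O : seq nat -> R.
Implicit Types (s : state R) (c : cmd) (Q : state R -> Prop).

(** A Hoare triple with a time bound, at a fixed initial state. *)
Definition runs c s (t : nat) Q : Prop :=
  ((exec O c s).2 <= t)%N /\ Q (exec O c s).1.

Lemma runs_weaken c s t t' Q Q' :
  runs c s t Q -> (t <= t')%N -> (forall s', Q s' -> Q' s') -> runs c s t' Q'.
Proof.
by move=> [le_t q] le_tt' QQ'; split; [exact: leq_trans le_tt' | exact: QQ'].
Qed.

Lemma runs_seq c1 c2 s t1 T P Q :
  runs c1 s t1 P -> (t1 <= T)%N ->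
  (forall s', P s' -> runs c2 s' (T - t1) Q) -> runs (Seq c1 c2) s T Q.
Proof.
rewrite /runs /=; case: (exec O c1 s) => s1 u1 /= [le1 P1] le_t1T /(_ s1 P1).
by case: (exec O c2 s1) => s2 u2 /= [le2 ?]; split; first lia.
Qed.

Lemma runs_if b c1 c2 s T Q :
  (teval s b -> runs c1 s T Q) -> (teval s b = false -> runs c2 s T Q) ->
  runs (If b c1 c2) s T.+1 Q.
Proof.
rewrite /runs /=; case: (teval s b) => [/(_ isT) + _ | _ /(_ erefl)].
all: by case: (exec O _ s).
Qed.

Lemma runs_for a m c s N t (Inv : nat -> state R -> Prop) :
  neval s m = N -> Inv 0%N s ->
  (forall j s', (j < N)%N -> Inv j s' ->
     runs c (State (upd (nmem s') a 0 j) (rmem s')) t (Inv j.+1)) ->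
  runs (For a m c) s (N * t.+1).+1 (Inv N).
Proof.
move=> mN Inv0 step; rewrite /runs /= mN.
elim: N step {mN} => [|j IHj] step //=.
have [|] := IHj; first by move=> i s' /leqW; apply: step.
case: (iteri _ _ _) => s1 u1 /= le1 /(step j s1 (leqnn _)) [].
by case: (exec O c _) => s2 u2 /= le2 ?; split; first lia.
Qed.

End Programs.

Lemma computesP (R : realType) (P : problem R) (I : inst P) c T N M N' M' :
  runs (fun w => odflt 0 (oracle I w)) c
    (load (nat_data I ++ N) (real_data I ++ M)) T
    (fun s => holds s N' M') ->
  computes I c T N M N' M'.
Proof. by rewrite /runs /computes; case: exec => s t []. Qed.

(** * The three programs *)

(** The bases are the first two blocks of the flow, which is loaded behind the
    three arrays of the instance, hence as the array of reals number 3. *)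
Definition back : cmd :=
  let e := NGet 1 (NLit 0) in
  For 1 (NGet 0 (NLit 0))
    (Seq (RSet 0 e (RGet 3 e))
         (RSet 1 e (RGet 3 (NAdd (NGet 0 (NLit 0)) e)))).

(** A query to the network is a word [b, v, bits] in array 1; the block of
    [bits] that matters starts at [b * n], and [b] also names the rank function
    to ask.  The vertex is determined by [b]: with any other vertex the word is
    not a query. *)
Definition sim : cmd :=
  let n := NGet 0 (NLit 0) in
  let e := NGet 3 (NLit 0) in
  let offset := NGet 4 (NLit 0) in
  Seq (NSet 2 (NLit 0) (NGet 1 (NLit 0)))
  (Seq (If (NLe (NLit 1) (NGet 1 (NLit 0))) (NSet 4 (NLit 0) n) Skip)
  (Seq (For 3 n (NSet 2 (NAdd (NLit 1) e)
              (NGet 1 (NAdd (NLit 2) (NAdd offset e)))))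
       (Ask 0 (NLit 0) 2 (NAdd (NLit 1) n)))).

Definition program : seq cmd -> cmd := foldr Seq Skip.

(** One row of [arc_table] for the arc held in cell 6.  The instance sits where
    no write happens: [n] in array 5 of naturals; the costs in arrays 3 and 2 of
    reals; the bound [k] and both ranks of the ground set in array 4. *)
Definition write_arc : cmd :=
  let n := NGet 5 (NLit 0) in
  let a := NGet 6 (NLit 0) in
  let n2 := NAdd n n in
  let n4 := NAdd n2 n2 in
  let below m := NLe (NAdd (NLit 1) a) m in
  let elt m := NAdd (NLit 4) (NSub a m) in
  let zero := RNat (NLit 0) in
  let put t h c l :=
    program [:: NSet 1 a t; NSet 2 a h; RSet 0 a c; RSet 1 a l] in
  If (below n) (put (NLit source) (NAdd (NLit 4) a) (RGet 3 a) zero)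
  (If (below n2) (put (elt n) (NLit sink) (RGet 2 (NSub a n)) zero)
  (If (below (NAdd n2 n)) (put (elt n2) (NLit pool) zero zero)
  (If (below n4) (put (NLit hub) (elt (NAdd n2 n)) zero zero)
  (If (below (NAdd n4 (NLit 1)))
    (put (NLit hub) (NLit source) zero (RGet 4 (NLit 1)))
  (If (below (NAdd n4 (NLit 2)))
    (put (NLit sink) (NLit hub) zero (RGet 4 (NLit 2)))
    (put (NLit hub) (NLit pool) zero
      (RSub (RGet 4 (NLit 0)) (RGet 4 (NLit 1))))))))).

(** The output overwrites the arrays 0 and 1 of the input, whence the copies.
    Array 7 is the query word [b, 1, ..., 1] for the rank of the whole ground
    set, with [b = 0] and then [b = 1].  The arrays 3 and 4 of naturals, telling
    which vertices are constrained, are 0 except at the source and the sink. *)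
Definition build : cmd :=
  let n := NGet 5 (NLit 0) in
  let a := NGet 6 (NLit 0) in
  let m := NAdd (NAdd (NAdd n n) (NAdd n n)) (NLit 3) in
  program
    [:: NSet 5 (NLit 0) (NGet 0 (NLit 0));
        RSet 4 (NLit 0) (RGet 0 (NLit 0));
        For 6 n (Seq (NSet 7 (NAdd (NLit 1) a) (NLit 1)) (RSet 3 a (RGet 1 a)));
        Ask 4 (NLit 1) 7 (NAdd (NLit 1) n);
        NSet 7 (NLit 0) (NLit 1);
        Ask 4 (NLit 2) 7 (NAdd (NLit 1) n);
        For 6 m write_arc;
        NSet 0 (NLit 0) (NAdd (NLit 4) n);
        NSet 0 (NLit 1) m;
        NSet 3 (NLit 0) (NLit 1);
        NSet 4 (NLit 1) (NLit 1)].

(** * Correctness of the programs *)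

Section Correctness.
Variables (R : realType) (I : rpb_inst R).
Local Notation n := (rpb_n I).

Lemma isize_rpb : @isize R (recoverable_polymatroid_basis R) I = (n + n + 2)%N.
Proof. rewrite /isize /= !size_codom !card_ord; lia. Qed.

Lemma isize_network :
  @isize R (polymatroidal_flow R) (network I) = (18 * n + 22)%N.
Proof. rewrite /isize /= !size_codom !card_ord /num_arcs; lia. Qed.

Lemma back_correct (phi : 'I_(num_arcs I) -> R) T : (n * 3 + 1 <= T)%N ->
  @computes R (recoverable_polymatroid_basis R) I back T [::] [:: codom phi]
    [::] [:: codom (phi \o @xarc _ I); codom (phi \o @yarc _ I)].
Proof.
move=> leT; apply: computesP; rewrite /back.
pose Inv j (s : state R) := [/\ nmem s 0 0 = n,
  forall i, rmem s 3 i = nth 0 (codom phi) i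
  & forall i, (i < j)%N -> rmem s 0 i = nth 0 (codom phi) i /\
                           rmem s 1 i = nth 0 (codom phi) (n + i)].
apply: runs_weaken (runs_for (N := n) (Inv := Inv) (t := 2) _ _ _) _ _.
- by [].
- by split=> // -[].
- move=> j s _ [sn phis done_j]; split=> //; split=> //= i lt_ij.
  rewrite /upd /= sn !phis.
  case: eqP => [-> //|ne_ij].
  by apply: done_j; lia.
- lia.
move=> s [_ _ done_n]; split=> [[|a] //|[|[|a]] j] /=; rewrite ?nth_nil //;
  rewrite size_codom card_ord => lt_jn.
- have := (done_n j lt_jn).1; rewrite -[j]/(val (xarc (Ordinal lt_jn))).
  by rewrite nth_codom_ord -[j]/(val (Ordinal lt_jn)) nth_codom_ord.
- have := (done_n j lt_jn).2; rewrite -[(n + j)%N]/(val (yarc (Ordinal lt_jn))).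
  by rewrite nth_codom_ord -[j]/(val (Ordinal lt_jn)) nth_codom_ord.
Qed.

Lemma sim_correct (w : seq nat) (r : R) T :
  @pf_oracle R (network I) w = Some r -> (n * 3 + 20 <= T)%N ->
  @computes R (recoverable_polymatroid_basis R) I sim T
    [:: w] [::] [::] [:: [:: r]].
Proof.
move=> answer leT; apply: computesP.
have [b [off [val_r [w0 offE]]]] : exists b off,
   @rpb_oracle R I (b :: mkseq (fun i => nth 0%N w (2 + (off + i))) n) = Some r
   /\ nth 0%N w 0 = b /\ off = (if (1 <= b)%N then n else 0)%N.
  case: w answer => [//|b [//|v bits]] /=; case: insub => // v'.
  case: b => [|[|//]] /=; rewrite /value_on.
    case: ifP => // _; case: ifP => // _ [<-].
    exists 0%N, 0%N; split=> //=; congr Some; congr rpb_f1.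
    by apply/setP=> e; rewrite !inE nth_mkseq.
  case: ifP => // _; case: ifP => // _ [<-].
  exists 1%N, n; split=> //=; congr Some; congr rpb_f2.
  by apply/setP=> e; rewrite !inE nth_mkseq.
pose Ready (s : state R) := [/\ nmem s 0 0 = n,
  forall i, nmem s 1 i = nth 0%N w i, nmem s 2 0 = b & nmem s 4 0 = off].
pose Inv j (s : state R) := Ready s /\
  forall i, (i < j)%N -> nmem s 2 i.+1 = nth 0%N w (2 + (off + i)).
apply: (runs_seq (t1 := 1) (P := fun s =>
  [/\ nmem s 0 0 = n, forall i, nmem s 1 i = nth 0%N w i, nmem s 2 0 = b
    & nmem s 4 0 = 0%N])); [by split | lia |].
move=> {}s [sn sw sb s4].
apply: (runs_seq (t1 := 2) (P := Ready)); [ | lia |].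
  rewrite /runs /Ready /= sw w0 offE; case: ifP => _ /=; split=> //; split=> //.
move=> {sn sw sb s4} s ready.
apply: (runs_seq (t1 := (n * 2).+1) (P := Inv n)); [ | lia |].
  apply: runs_for => //; first by case: ready.
  move=> j {ready}s lt_jn [[sn sw sb s4] sq]; split=> //; split; first by split.
  move=> i lt_ij; rewrite /= /upd /= eqSS.
  by case: eqP => [->|ne_ij]; [rewrite s4 sw | apply: sq; lia].
move=> {ready}s [[sn sw sb s4] sq].
have word : mkseq (nmem s 2) (neval s (NAdd (NLit 1) (NGet 0 (NLit 0)))) =
    b :: mkseq (fun i => nth 0%N w (2 + (off + i))) n.
  rewrite /= sn add1n /mkseq /= sb; congr (_ :: _).
  rewrite -[1%N]/(1 + 0)%N iotaDl -map_comp; apply/eq_in_map => i.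
  by rewrite mem_iota => lti; apply: sq.
rewrite /runs /exec word; split; first by rewrite /= size_mkseq; lia.
split=> [[|a] //|[|a] [|j]] //=; rewrite ?nth_nil // => _.
by rewrite -[r]/(odflt 0 (Some r)) -val_r.
Qed.

End Correctness.

Section BuildCorrectness.
Variables (R : realType) (I : rpb_inst R).
Local Notation n := (rpb_n I).
Local Notation rank1 := (@rpb_f1 R I [set: 'I_n]).
Local Notation rank2 := (@rpb_f2 R I [set: 'I_n]).
Local Notation O := (fun w => odflt 0 (@rpb_oracle R I w)).

Definition inputs (s : state R) : Prop :=
  [/\ nmem s 5 0 = n,
      forall i, rmem s 3 i = (codom (@rpb_c1 R I))`_i,
      forall i, rmem s 2 i = (codom (@rpb_c2 R I))`_i
    & forall i, nmem s 3 i = 0%N /\ nmem s 4 i = 0%N].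

Definition constants (s : state R) : Prop :=
  [/\ rmem s 4 0 = (rpb_k I)%:~R, rmem s 4 1 = rank1 & rmem s 4 2 = rank2].

Lemma write_arc_runs s j :
  inputs s -> constants s -> nmem s 6 0 = j ->
  runs O write_arc s 12 (fun s' => s' =
    State (upd (upd (nmem s) 1 j (src (arcs I j))) 2 j (dst (arcs I j)))
          (upd (upd (rmem s) 0 j (price (arcs I j))) 1 j (least (arcs I j)))).
Proof.
move=> [sn c1s c2s _] [k0 r1 r2] cnt; rewrite /arcs /arc_table.
repeat (apply: runs_if; rewrite /= ?sn cnt add1n => -> /=).
all: by split=> //=; rewrite !upd_other // ?cnt ?sn ?c1s ?c2s ?k0 ?r1 ?r2.
Qed.

Lemma table_runs s :
  inputs s -> constants s ->
  runs O (For 6 (NAdd (NAdd (NAdd (NGet 5 (NLit 0)) (NGet 5 (NLit 0)))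
      (NAdd (NGet 5 (NLit 0)) (NGet 5 (NLit 0)))) (NLit 3)) write_arc)
    s (num_arcs I * 13).+1 (fun s' => inputs s' /\
      forall i, (i < num_arcs I)%N ->
      [/\ nmem s' 1 i = src (arcs I i), nmem s' 2 i = dst (arcs I i),
          rmem s' 0 i = price (arcs I i) & rmem s' 1 i = least (arcs I i)]).
Proof.
move=> ins consts.
pose written j (s' : state R) := forall i, (i < j)%N ->
  [/\ nmem s' 1 i = src (arcs I i), nmem s' 2 i = dst (arcs I i),
      rmem s' 0 i = price (arcs I i) & rmem s' 1 i = least (arcs I i)].
pose Inv j s' := [/\ inputs s', constants s' & written j s'].
apply: (runs_weaken (runs_for (N := num_arcs I) (Inv := Inv) (t := 12) _ _ _)).
- by rewrite /=; case: ins => ->.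
- by split.
- move=> j {ins consts}s lt_j [ins consts wr].
  apply: runs_weaken (write_arc_runs (j := j) _ _ _) (leqnn _) _ => //.
  move=> _ ->; case: ins consts => [sn c1s c2s flags] [k0 r1 r2].
  split=> // i lt_ij; rewrite /= /upd /=.
  by case: eqP => [->|ne_ij] //; apply: wr; lia.
- by [].
- by move=> s' [].
Qed.

Lemma rank_query (b : nat) (mem : nat -> nat) (f : {set 'I_n} -> R) :
  (forall bits, @rpb_oracle R I (b :: bits) = Some (f (set_of_bits n bits))) ->
  mem 0%N = b -> (forall i, (i < n)%N -> mem i.+1 = 1%N) ->
  O (mkseq mem (1 + n)) = f [set: 'I_n].
Proof.
move=> orE mem0 mem1.
have -> : mkseq mem (1 + n) = b :: mkseq (mem \o S) n.
  by rewrite add1n /mkseq /= mem0 -[1%N]/(1 + 0)%N iotaDl -map_comp.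
rewrite orE /=; congr f; apply/setP=> e.
by rewrite !inE nth_mkseq // /= mem1.
Qed.

Lemma build_correct T : (n * 60 + 80 <= T)%N ->
  @computes R (recoverable_polymatroid_basis R) I build T [::] [::]
    (@pf_nat_data R (network I)) (@pf_real_data R (network I)).
Proof.
move=> leT; apply: computesP.
pose base (s : state R) := [/\ nmem s 5 0 = n, nmem s 7 0 = 0%N,
  forall i, rmem s 1 i = (codom (@rpb_c1 R I))`_i,
  forall i, rmem s 2 i = (codom (@rpb_c2 R I))`_i
  & forall i, nmem s 3 i = 0%N /\ nmem s 4 i = 0%N].
pose copied j (s : state R) := [/\ base s, rmem s 4 0 = (rpb_k I)%:~R,
  forall i, (i < j)%N -> nmem s 7 i.+1 = 1%N
  & forall i, rmem s 3 i = if (i < j)%N then (codom (@rpb_c1 R I))`_i else 0].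
pose ready (s : state R) := [/\ inputs s, rmem s 4 0 = (rpb_k I)%:~R
  & forall i, (i < n)%N -> nmem s 7 i.+1 = 1%N].
apply: (runs_seq (t1 := 1) (P := fun s =>
  [/\ base s, rmem s 0 0 = (rpb_k I)%:~R & forall i, rmem s 3 i = 0])).
- by split=> //; split; [split=> // i; case: i | | case].
- lia.
move=> s [bas k0 r3].
apply: (runs_seq (t1 := 1) (P := copied 0%N)); [by split | lia |].
move=> {bas k0 r3}s copied0.
apply: (runs_seq (t1 := (n * 3).+1)
  (P := fun s => ready s /\ nmem s 7 0 = 0%N)).
- apply: runs_weaken (runs_for (N := n) (Inv := copied) (t := 2) _ copied0 _)
    _ _.
  + by case: copied0 => -[].
  + move=> j {copied0}s lt_jn [[s5 s7 c1s c2s flags] k0 q c1'].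
    split=> //; split=> // i; rewrite /= /upd /= ?eqSS.
      by case: eqP => // ne_ij lt_ij; apply: q; lia.
    rewrite c1s c1'; case: eqP => [->|ne_ij]; first by rewrite ltnSn.
    by have -> : (i < j.+1)%N = (i < j)%N by lia.
  + by [].
  move=> {copied0}s [[s5 s7 c1s c2s flags] k0 q c1']; split=> //; split=> //.
  (* Beyond [n] the copy still holds the initial 0, the default of [nth]. *)
  split=> // i; rewrite c1'; case: ltnP => // le_ni.
  by rewrite nth_default // size_codom card_ord.
- lia.
move=> {copied0}s [[ins k0 q] s7].
apply: (runs_seq (t1 := n.+2) (P := fun s => ready s /\ rmem s 4 1 = rank1)).
- have ask : O (mkseq (nmem s 7) (neval s (NAdd (NLit 1) (NGet 5 (NLit 0))))) =
      rank1.
    by rewrite /=; case: ins => -> _ _ _; apply: rank_query s7 q.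
  rewrite /runs /exec ask size_mkseq; case: ins => s5 c1s c2s flags.
  by split; rewrite /= ?s5.
- lia.
move=> {ins k0 q s7}s [[[s5 c1s c2s flags] k0 q] r1].
apply: (runs_seq (t1 := 1)
  (P := fun s => [/\ ready s, rmem s 4 1 = rank1 & nmem s 7 0 = 1%N])).
- by [].
- lia.
move=> {s5 c1s c2s flags k0 q r1}s [[ins k0 q] r1 s7].
apply: (runs_seq (t1 := n.+2) (P := fun s => inputs s /\ constants s)).
- have ask : O (mkseq (nmem s 7) (neval s (NAdd (NLit 1) (NGet 5 (NLit 0))))) =
      rank2.
    by rewrite /=; case: ins => -> _ _ _; apply: rank_query s7 q.
  rewrite /runs /exec ask size_mkseq; case: ins => s5 c1s c2s flags.
  by split; rewrite /= ?s5.
- lia.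
move=> {ins k0 q r1 s7}s [ins consts].
apply: (runs_seq (table_runs ins consts)).
  by rewrite /num_arcs; lia.
move=> {ins consts}s [[s5 _ _ flags] table].
split; first by rewrite /= /num_arcs; lia.
split.
  case=> [|[|[|[|[|a]]]]] j;
    rewrite /= ?nth_nil ?size_codom ?card_ord // => lt_j.
  - by move: j lt_j => [|[|]] //= _; rewrite /upd /= s5.
  - rewrite !upd_other //; case: (table j lt_j) => -> _ _ _.
    by rewrite -[j]/(val (Ordinal lt_j)) nth_codom_ord; apply/esym/tailE.
  - rewrite !upd_other //; case: (table j lt_j) => _ -> _ _.
    by rewrite -[j]/(val (Ordinal lt_j)) nth_codom_ord; apply/esym/headE.
  - rewrite -[j]/(val (Ordinal lt_j)) nth_codom_ord /=.
    by rewrite upd_other // /upd /= /source; case: eqP => //= _;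
      case: (flags j).
  - rewrite -[j]/(val (Ordinal lt_j)) nth_codom_ord /=.
    by rewrite /upd /= /sink; case: eqP => //= _; case: (flags j).
case=> [|[|a]] j; rewrite /= ?nth_nil ?size_codom ?card_ord // => lt_j.
- case: (table j lt_j) => _ _ -> _.
  by rewrite -[j]/(val (Ordinal lt_j)) nth_codom_ord.
- case: (table j lt_j) => _ _ _ ->.
  by rewrite -[j]/(val (Ordinal lt_j)) nth_codom_ord.
Qed.
End BuildCorrectness.

(** * The reduction *)

Theorem theorem4 (R : realType) :
  poly_reducible (recoverable_polymatroid_basis R) (polymatroidal_flow R).
Proof.
exists build, sim, back, 100%N, 1%N => I valid_I.
exists (network I); rewrite isize_rpb expn1; split.
- by split; [exact: network_valid | rewrite isize_network; lia].
- by apply: build_correct; lia.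
- by move=> w r answer; apply: sim_correct answer _; lia.
- exact: network_equivalent.
move=> phi opt; exists (phi \o @xarc _ I, phi \o @yarc _ I).
by split; [exact: optimal_flow_to_bases | apply: back_correct; lia].
Qed.
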